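(* Let $A,B,X$ be complex $d\times d$ matrices and let $|||\cdot|||$ be an arbitrary unitarily invariant norm on the $d\times d$ complex matrices. Then $$|||AXB^*|||^2\leq|||(A^*A)^mX(B^*B)^s|||\;|||(A^*A)^nX(B^*B)^t|||,$$ where $m,n,s,t$ are real numbers such that $m+n=s+t=1$. In particular, if $A$ and $B$ are positive definite, then $$|||A^{\frac{1}{2}}XB^{\frac{1}{2}}|||^2\leq|||A^p XB^{1-p}|||\;|||A^{1-p}XB^p|||,$$ where $p\in[0,1]$.
   Context: A norm $|||\cdot|||$ on the $d\times d$ complex matrices is unitarily invariant if $|||UAV|||=|||A|||$ for all matrices $A$ and all unitary matrices $U,V$. Powers of positive semidefinite matrices are understood in the sense of the functional calculus for Hermitian matrices. *)

(* Defs.v *)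
From HB Require Import structures.
From mathcomp Require Import all_boot all_order all_algebra.
From mathcomp Require Export complex.
From mathcomp Require Export reals exp.

Set Implicit Arguments.
Unset Strict Implicit.
Unset Printing Implicit Defensive.

Import Order.TTheory GRing.Theory Num.Theory.

Local Open Scope ring_scope.
Local Open Scope complex_scope.
Local Open Scope sesquilinear_scope.

(* Complex matrices are matrices over R[i], R : realType; A ^t* is the
   conjugate transpose. *)

Section MatrixDefs.
Variables (R : realType) (d : nat).
Implicit Types (A U V : 'M[R[i]]_d) (N : 'M[R[i]]_d -> R).

(* Normc.normc is the modulus R[i] -> R; the generic `|z| is R[i]-valued. *)
Definition matrix_norm N : Prop :=
  [/\ forall A, 0 <= N A,
      forall A, N A = 0 -> A = 0,
      forall (a : R[i]) A, N (a *: A) = Normc.normc a * N A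
    & forall A B, N (A + B) <= N A + N B].

Definition unitarily_invariant_norm N : Prop :=
  matrix_norm N /\
  forall A U V, U \is unitarymx -> V \is unitarymx -> N (U *m A *m V) = N A.

(* f(A) = W^-1 diag(f(lambda_1), ..., f(lambda_d)) W, where W is unitary and
   A = W^-1 diag(lambda_1, ..., lambda_d) W; meaningful for A Hermitian, where
   the lambda_j are real. *)
Definition funcalc (f : R -> R) A : 'M[R[i]]_d :=
  invmx (spectralmx A)
    *m diag_mx (map_mx (fun z => (f (complex.Re z))%:C) (spectral_diag A))
    *m spectralmx A.

(* A^x for A positive semidefinite.  The scalar powR satisfies 0 `^ 0 = 1 and
   0 `^ x = 0 for x != 0: for x < 0 and A singular this is the power of the
   inverse of A on its range, extended by 0 on its kernel. *)
Definition mxpowR A (x : R) : 'M[R[i]]_d := funcalc (fun a => a `^ x) A.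

Definition posdefmx A : Prop :=
  A \is hermsymmx /\
  forall v : 'cV[R[i]]_d, v != 0 -> 0 < (v ^t* *m A *m v) 0 0.

End MatrixDefs.

(* Main.v *)
Require Import Defs.
From mathcomp Require Import all_boot all_order all_algebra.
From mathcomp Require Import spectral ring lra.
From mathcomp Require Import sequences trigo.
From mathcomp Require boolp classical_sets functions topology normedtype derive realfun.
Local Open Scope ring_scope.
Local Open Scope complex_scope.
Local Open Scope sesquilinear_scope.

Set Implicit Arguments.
Unset Strict Implicit.
Unset Printing Implicit Defensive.

Import Order.TTheory GRing.Theory Num.Theory.

(** Diagonalising A^*A and B^*B (and using the polar decompositions of A and B)
    reduces the claim to f(0)^2 <= f(1) f(-1), where f(x) is the norm of the
    matrix G(x) with entries e^(x theta_jk) Z_jk, theta_jk = alpha_j + beta_k.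
    Multiplying entrywise by e^(i h theta_jk) amounts to multiplying by diagonal
    unitaries on both sides, so cos(h theta) o (G(x + h) + G(x - h)) / 2 has norm
    at most (f(x + h) + f(x - h)) / 2.  On the other hand its entries are
    cos(h theta_jk) cosh(h theta_jk) G(x)_jk, and cos y cosh y = 1 + o(y^2):
    hence f(x) <= (f(x + h) + f(x - h)) / 2 + o(h^2), which forces
    f(0) <= (f(1) + f(-1)) / 2.  Translating alpha by ln t gives
    2 f(0) <= t f(1) + f(-1) / t for all t > 0, and optimising t concludes.
    Zero eigenvalues are handled by the compression of a matrix to the supports,
    an average of unitary conjugates. *)

(** * Scalar estimates: cos against cosh, discrete convexity, optimisation of a scaling *)

Section RealAnalysis.
Import boolp classical_sets functions topology normedtype derive realfun.
Import numFieldNormedType.Exports.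
Local Open Scope classical_set_scope.
Variable R : realType.
Implicit Types x y : R.

Lemma cvg_slope0 (f : R -> R) (l : R) :
  is_derive (0 : R) (1 : R) f l -> f 0 = 0 -> f y / y @[y --> (0 : R)^'] --> l.
Proof.
move=> [df <-] f0.
have := df; rewrite /derivable /= => /cvg_ex[/= k hk].
rewrite /derive (cvg_lim _ hk)//.
apply: cvg_trans hk; apply: near_eq_cvg; near=> y.
by rewrite /= f0 subr0 addr0 /GRing.scale /= mulr1 mulrC.
Unshelve. all: by end_near. Qed.

Definition cosh x : R := (expR x + expR (- x)) / 2.
Definition sinh x : R := (expR x - expR (- x)) / 2.

Lemma cosh_double x : cosh (x *+ 2) = 1 + 2 * sinh x ^+ 2.
Proof.
have h := expRxMexpNx_1 x.
rewrite /cosh /sinh -mulNrn !mulr2n !expRD.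
set a := expR x in h *; set b := expR (- x) in h *.
have -> : (a * a + b * b) / 2 = a * b + 2 * ((a - b) / 2) ^+ 2 by field.
by rewrite h.
Qed.

(** The double-argument formulas turn the numerator into 2 sin^2 y - 2 sinh^2 y + 4 sin^2 y sinh^2
    y. After division by y^2 the first two terms tend to 2 and -2, and the last to 0 because sinh y
    does. *)
Lemma cvg_one_sub_cosMcosh :
  (1 - cos (y *+ 2) * cosh (y *+ 2)) / y ^+ 2 @[y --> (0 : R)^'] --> (0 : R).
Proof.
have hs : sin y / y @[y --> (0 : R)^'] --> (1 : R).
  by apply: cvg_slope0; [rewrite -[X in is_derive _ _ _ X]cos0; exact: is_derive_sin|rewrite sin0].
have hS : sinh y / y @[y --> (0 : R)^'] --> (1 : R).
  apply: cvg_slope0; last by rewrite /sinh oppr0 subrr mul0r.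
  have h1 : is_derive (0 : R) 1 (fun x => expR (- x)) (- 1).
    have hN : is_derive (0 : R) (1 : R) -%R (- 1) by exact: is_deriveNid.
    have h0 : is_derive (- (0 : R)) (1 : R) expR (1 : R).
      by rewrite oppr0 -[X in is_derive _ _ _ X]expR0; exact: is_derive_expR.
    by have := is_derive1_comp h0 hN; rewrite mul1r.
  have h2 : is_derive (0 : R) 1 expR (1 : R).
    by rewrite -[X in is_derive _ _ _ X]expR0; exact: is_derive_expR.
  have -> : sinh = 2^-1 *: ((expR : R -> R) - (fun x => expR (- x))).
    by apply/funext => x; rewrite /sinh !fctE mulrC.
  have := is_deriveZ 2^-1 (is_deriveB h2 h1).
  by rewrite opprK /GRing.scale /= -mulr2n mulVf ?pnatr_eq0.
have hS0 : sinh y @[y --> (0 : R)^'] --> (0 : R).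
  have : sinh y / y * y @[y --> (0 : R)^'] --> (1 * 0 : R).
    by apply: cvgM hS _; apply: nbhs_dnbhs.
  rewrite mulr0; apply: cvg_trans; apply: near_eq_cvg; near=> y.
  by rewrite divfK//; near: y; exact: nbhs_dnbhs_neq.
have F0 : Filter (0 : R)^' by exact: dnbhs_filter.
have /(_ F0) hss := cvgM hs hs; have /(_ F0) hSS := cvgM hS hS.
have /(_ F0) hS00 := cvgM hS0 hS0.
have c2 := @cvg_cst _ (2 : R) _ (0 : R)^' F0;
have c4 := @cvg_cst _ (4 : R) _ (0 : R)^' F0.
have /(_ F0 F0 F0 F0 F0 F0) := cvgD (cvgB (cvgM c2 hss) (cvgM c2 hSS)) (cvgM (cvgM c4 hss) hS00).
have -> : 2 * (1 * 1) - 2 * (1 * 1) + 4 * (1 * 1) * (0 * 0) = 0 :> R by ring.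
apply: cvg_trans; apply: near_eq_cvg; near=> y.
have y0 : y != 0 by near: y; exact: nbhs_dnbhs_neq.
rewrite cosh_double cos_mulr2n cos2sin2 !fctE /=.
by field.
Unshelve. all: by end_near. Qed.

Lemma one_sub_cosMcosh_small (e : R) : 0 < e -> exists2 b : R, 0 < b &
  forall y, `|y| < b -> `|1 - cos y * cosh y| <= e * y ^+ 2.
Proof.
move=> e0; have /cvgrPdist_lt/(_ e e0) := cvg_one_sub_cosMcosh.
rewrite near_withinE /= => /nbhs_ballP[b /= b0 hb].
exists b => // y yb; have [->|y0] := eqVneq y 0.
  by rewrite cos0 /cosh oppr0 expR0 expr0n/= mulr0 mul1r -mulr2n divff ?subrr ?normr0 ?pnatr_eq0.
have h2 : (y / 2) *+ 2 = y by rewrite -mulr_natr divfK ?pnatr_eq0.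
(* The limit is stated for doubled arguments, so it is used at y / 2. *)
have := hb (y / 2); rewrite /ball /= !sub0r normrN h2 mulf_neq0 ?invr_neq0 ?pnatr_eq0//.
rewrite normrM normfV (ger0_norm (_ : 0 <= 2)) ?ler0n// => hh.
have {hh}/hh/(_ isT) : `|y| / 2 < b by apply: le_lt_trans yb; have := normr_ge0 y; lra.
rewrite normrN normrM normfV [`|(y / 2) ^+ 2|]ger0_norm ?sqr_ge0//.
rewrite ltr_pdivrMr ?exprn_even_gt0//= ?mulf_neq0 ?invr_neq0 ?pnatr_eq0//.
move=> /ltW/le_trans; apply; rewrite ler_wpM2l ?(ltW e0)//.
by rewrite exprMn; have := sqr_ge0 y; lra.
Qed.

(** Each second difference raises the bound on the drop [u k - u k.+1] by at most 2 [del], so this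
    drop is at most (2k + 1) [del]; the first n odd numbers add up to n^2. *)
Lemma discrete_almost_convex (u : nat -> R) (del : R) (n : nat) : 0 <= del ->
  u 0%N - u 1%N <= del ->
  (forall k, (k.+1 < n)%N -> 2 * u k.+1 - u k - u k.+2 <= 2 * del) ->
  u 0%N - u n <= n%:R ^+ 2 * del.
Proof.
move=> del0 h0 hs.
have hd k : (k < n)%N -> u k - u k.+1 <= (k%:R *+ 2 + 1) * del.
  elim: k => [|k ih] kn; first by rewrite mul0rn add0r mul1r.
  by have := hs k kn; rewrite -[in k.+1%:R]natr1; move: (ih (ltnW kn)); rewrite !mulr2n; lra.
suff: forall k, (k <= n)%N -> u 0%N - u k <= k%:R ^+ 2 * del by exact.
elim=> [|k ih] kn; first by rewrite subrr expr0n mul0r.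
by have := hd k kn; have := ih (ltnW kn); rewrite -natr1 sqrrD1; lra.
Qed.

Lemma le_of_forall_addM (a b M : R) :
  (forall e, 0 < e -> a <= b + e * M) -> a <= b.
Proof.
move=> h; rewrite leNgt; apply/negP => ba.
have M0 : 0 < M by have := h 1 ltr01; lra.
have := h ((a - b) / (2 * M)) (divr_gt0 _ _).
rewrite subr_gt0 mulr_gt0// => /(_ ba isT).
have -> : (a - b) / (2 * M) * M = (a - b) / 2 by field; rewrite gt_eqF.
lra.
Qed.

Lemma mul_le_of_scaled_mean (f a b : R) : 0 <= f -> 0 <= a -> 0 <= b ->
  (forall t, 0 < t -> 2 * f <= t * a + t^-1 * b) -> f ^+ 2 <= a * b.
Proof.
rewrite le0r => /predU1P[-> a0 b0 _|f0 + b0 h]; first by rewrite expr0n mulr_ge0.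
rewrite le0r => /predU1P[a0|a0].
  (* If a = 0, this t gives 2f <= f b / (b + 1) < f, which is absurd for f > 0. Otherwise t = f / a
     below balances the two sides. *)
  have := h ((b + 1) / f) (divr_gt0 (ltr_wpDl b0 ltr01) f0).
  rewrite a0 mulr0 add0r invf_div; have b1 : 0 < b + 1 by rewrite ltr_wpDl.
  have : f / (b + 1) * (b + 1) = f by rewrite divfK ?gt_eqF.
  by have := divr_gt0 f0 b1; lra.
have := h _ (divr_gt0 f0 a0); rewrite divfK ?gt_eqF// invf_div => h1.
have : f <= a / f * b by lra.
by rewrite mulrAC ler_pdivlMr// expr2.
Qed.

End RealAnalysis.

(** * Unitarily invariant norms: phases, exponential families, compressions *)

Section UnitarilyInvariant.
Variables (R : realType) (d : nat) (N : 'M[R[i]]_d -> R).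
Hypothesis N_ui : unitarily_invariant_norm N.
Implicit Types (A U V Z M : 'M[R[i]]_d).

Lemma uinorm_ge0 A : 0 <= N A.
Proof. by have [[]] := N_ui. Qed.

Lemma uinorm_scale (a : R) A : 0 <= a -> N (a%:C *: A) = a * N A.
Proof.
move=> a0; have [[_ _ -> _] _] := N_ui.
by rewrite /= expr0n addr0 sqrtr_sqr ger0_norm.
Qed.

Lemma uinormD A B : N (A + B) <= N A + N B.
Proof. by have [[]] := N_ui. Qed.

Lemma uinorm_unitary A U V :
  U \is unitarymx -> V \is unitarymx -> N (U *m A *m V) = N A.
Proof. by have [_] := N_ui; apply. Qed.

Lemma uinorm0 : N 0 = 0.
Proof. by rewrite -(scale0r (0 : 'M_d)) (uinorm_scale _ (lexx 0)) mul0r. Qed.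

Lemma uinorm_sum I (r : seq I) (F : I -> 'M_d) :
  N (\sum_(l <- r) F l) <= \sum_(l <- r) N (F l).
Proof.
elim/big_ind2: _ => [|M1 x1 M2 x2 h1 h2|//]; first by rewrite uinorm0.
exact: le_trans (uinormD _ _) (lerD h1 h2).
Qed.

(** Expansion in matrix units. It makes a matrix with small entries small in norm, with explicit
    constants. *)
Lemma uinorm_le_entries A :
  N A <= \sum_j \sum_k Normc.normc (A j k) * N (delta_mx j k).
Proof.
rewrite {1}[A]matrix_sum_delta; apply: le_trans (uinorm_sum _ _) _.
apply: ler_sum => j _; apply: le_trans (uinorm_sum _ _) _.
by apply: ler_sum => k _; have [[_ _ -> _] _] := N_ui.
Qed.

Definition phase (x : R) : R[i] := cos x +i* sin x.

Lemma phaseD x y : phase (x + y) = phase x * phase y.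
Proof. by rewrite /phase cosD sinD [RHS]/GRing.mul /= [sin x * _ + _]addrC. Qed.

Lemma phaseDN x : phase x + phase (- x) = (2 * cos x)%:C.
Proof. by rewrite /phase cosN sinN [LHS]/GRing.add /= subrr -mulr2n mulr_natl. Qed.

Lemma phase_unimod x : phase x * (phase x)^* = 1.
Proof.
by rewrite /phase [LHS]/GRing.mul /= !mulrN opprK -!expr2 cos2Dsin2 [sin x * _]mulrC addNr.
Qed.

Lemma diag_mx_unitary (u : 'rV[R[i]]_d) :
  (forall j, u 0 j * (u 0 j)^* = 1) -> diag_mx u \is unitarymx.
Proof.
move=> hu; apply/unitarymxP; apply/matrixP => j k.
rewrite mul_diag_mx !mxE eq_sym.
by case: eqVneq => [->|_]; rewrite ?mulr1n ?hu// mulr0n rmorph0 mulr0.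
Qed.

Lemma diag_sandwichE (u v : 'rV[R[i]]_d) M j k :
  (diag_mx u *m M *m diag_mx v) j k = u 0 j * v 0 k * M j k.
Proof. by rewrite mul_mx_diag mxE mul_diag_mx mxE mulrAC. Qed.

(** The additive exponent splits each phase into a row factor and a column factor, that is, into two
    diagonal unitaries. *)
Lemma uinorm_phase (al be : 'I_d -> R) M :
  N (\matrix_(j, k) (phase (al j + be k) * M j k)) = N M.
Proof.
rewrite -[RHS](@uinorm_unitary _ (diag_mx (\row_j phase (al j)))
  (diag_mx (\row_k phase (be k)))); last 2 first.
- by apply: diag_mx_unitary => j; rewrite mxE phase_unimod.
- by apply: diag_mx_unitary => j; rewrite mxE phase_unimod.
by congr N; apply/matrixP => j k; rewrite diag_sandwichE !mxE phaseD.
Qed.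

(** This is e^(xD) Z e^(xD') with D and D' the real diagonal matrices of [al] and [be]. *)
Definition expmx (al be : 'I_d -> R) Z (x : R) : 'M[R[i]]_d :=
  \matrix_(j, k) ((expR (x * (al j + be k)))%:C * Z j k).

Lemma uinorm_expmx_midpoint al be Z (x h : R) :
  N (expmx al be Z x) <=
    (N (expmx al be Z (x + h)) + N (expmx al be Z (x - h))) / 2 +
    \sum_j \sum_k `|1 - cos (h * (al j + be k)) * cosh (h * (al j + be k))| *
       (expR (x * (al j + be k)) * Normc.normc (Z j k) * N (delta_mx j k)).
Proof.
set S := expmx al be Z (x + h) + expmx al be Z (x - h).
pose T (c : R) : 'M[R[i]]_d := \matrix_(j, k) (phase (c * al j + c * be k) * S j k).
pose E : 'M[R[i]]_d := \matrix_(j, k)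
  (((1 - cos (h * (al j + be k)) * cosh (h * (al j + be k))) *
   expR (x * (al j + be k)))%:C * Z j k).
(* The factor 1/4 combines the 1/2 of cos y = (e^(iy) + e^(-iy)) / 2 with the 1/2 of the mean of G(x
   + h) and G(x - h). [E] is the entrywise defect 1 - cos cosh, bounded through matrix units. *)
have -> : expmx al be Z x = (4^-1)%:C *: T h + (4^-1)%:C *: T (- h) + E.
  apply/matrixP => j k; rewrite !mxE !mulNr -opprD -[h * al j + _]mulrDr.
  set th := al j + be k; set z := Z j k.
  have -> (a b r p q : R[i]) :
      a * (p * (b * z + r * z)) + a * (q * (b * z + r * z)) = a * (p + q) * (b + r) * z.
    by ring.
  rewrite phaseDN -mulrDl -!(rmorphM, rmorphD) /=.
  congr (_%:C * _); rewrite [(x + h) * th]mulrDl [(x - h) * th]mulrBl !expRD /cosh.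
  by field.
have q0 : 0 <= 4^-1 :> R by rewrite invr_ge0.
apply: le_trans (uinormD _ _) (lerD _ _).
  apply: le_trans (uinormD _ _) _; rewrite !uinorm_scale// !uinorm_phase.
  have : N S <= _ := uinormD _ _.
  by lra.
apply: le_trans (uinorm_le_entries _) _.
apply: ler_sum => j _; apply: ler_sum => k _.
rewrite mxE Normc.normcM !mulrA ler_wpM2r ?uinorm_ge0// ler_wpM2r//.
  by case: (Z j k) => a b; rewrite sqrtr_ge0.
by rewrite /= expr0n addr0 sqrtr_sqr normrM (ger0_norm (expR_ge0 _)).
Qed.

(** The midpoint inequality is iterated on a grid of step h = 1/n. Its error is O(e h^2), and n^2
    such errors add up to O(e), with e arbitrary. *)
Lemma uinorm_expmx_mean al be Z :
  2 * N (expmx al be Z 0) <= N (expmx al be Z 1) + N (expmx al be Z (-1)).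
Proof.
pose th j k : R := al j + be k.
(* A bound for all exponents; the added 1 keeps it positive when they all vanish. *)
pose L := 1 + \sum_j \sum_k `|th j k|.
have s0 : 0 <= \sum_j \sum_k `|th j k| by apply: sumr_ge0 => j _; apply: sumr_ge0.
have thL j k : `|th j k| <= L.
  have h1 : `|th j k| <= \sum_k `|th j k| by rewrite (bigD1 k)//= lerDl sumr_ge0.
  have h2 : \sum_k `|th j k| <= \sum_j \sum_k `|th j k|.
    by rewrite [leRHS](bigD1 j)//= lerDl; apply: sumr_ge0 => *; apply: sumr_ge0.
  by rewrite /L; lra.
have L0 : 0 < L by rewrite ltr_pwDl.
(* Bounds the weights of the midpoint error uniformly over |x| <= 1. *)
pose K := \sum_j \sum_k (expR `|th j k| * Normc.normc (Z j k) * N (delta_mx j k)).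
have normc_ge0 (z : R[i]) : 0 <= Normc.normc z by case: z => *; exact: sqrtr_ge0.
have K0 : 0 <= K.
  apply: sumr_ge0 => j _; apply: sumr_ge0 => k _.
  by rewrite !mulr_ge0 ?expR_ge0 ?uinorm_ge0.
apply: (@le_of_forall_addM _ _ _ (2 * (K * L ^+ 2))) => e e0.
have [b b0 hb] := one_sub_cosMcosh_small e0.
(* Since n > L / b, every h [th j k] lies within b of 0, where the estimate on cos cosh applies. *)
pose n := (Num.truncn (L / b)).+1; pose h : R := n%:R^-1.
have n0 : 0 < n%:R :> R by rewrite ltr0n.
have h0 : 0 < h by rewrite invr_gt0.
have nh : n%:R * h = 1 by rewrite mulfV// gt_eqF.
have hL : h * L < b.
  by rewrite mulrC ltr_pdivrMr// mulrC -ltr_pdivrMr// truncnS_gt.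
have step (x : R) : `|x| <= 1 -> N (expmx al be Z x) <=
    (N (expmx al be Z (x + h)) + N (expmx al be Z (x - h))) / 2 + K * (e * L ^+ 2 * h ^+ 2).
  move=> x1; apply: le_trans (uinorm_expmx_midpoint al be Z x h) _.
  rewrite lerD2l /K mulr_suml; apply: ler_sum => j _.
  rewrite mulr_suml; apply: ler_sum => k _.
  rewrite mulrC -/(th j k); apply: ler_pM; rewrite ?mulr_ge0 ?expR_ge0 ?uinorm_ge0//.
    rewrite ler_wpM2r ?uinorm_ge0// ler_wpM2r// ler_expR.
    by apply: le_trans (ler_norm _) _; rewrite normrM ler_piMl.
  apply: le_trans (hb _ _) _.
    by apply: le_lt_trans hL; rewrite normrM (gtr0_norm h0) ler_pM2l.
  rewrite -mulrA ler_pM2l// exprMn mulrC ler_pM2r ?exprn_gt0//.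
  by rewrite -(real_normK (num_real (th j k))) ler_sqr ?nnegrE ?normr_ge0// ltW.
(* By symmetrisation, the midpoint inequality at 0 bounds the first drop [u 0 - u 1], which starts
   the discrete argument. *)
pose u (k : nat) := N (expmx al be Z (k%:R * h)) + N (expmx al be Z (- (k%:R * h))).
have := @discrete_almost_convex R u (2 * (K * (e * L ^+ 2 * h ^+ 2))) n.
have -> : n%:R ^+ 2 * (2 * (K * (e * L ^+ 2 * h ^+ 2))) = e * (2 * (K * L ^+ 2)).
  rewrite (_ : _ * _ = (n%:R * h) ^+ 2 * (e * (2 * (K * L ^+ 2)))); last by ring.
  by rewrite nh expr1n mul1r.
have -> : u n = N (expmx al be Z 1) + N (expmx al be Z (-1)) by rewrite /u nh.
have u0 : u 0%N = 2 * N (expmx al be Z 0) by rewrite /u mul0r oppr0 mulr_natl.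
rewrite u0 -lerBlDl; apply.
- by rewrite !mulr_ge0// ?exprn_ge0// ltW.
- have := step 0; rewrite normr0 add0r sub0r => /(_ ler01).
  by rewrite /u mul1r; lra.
move=> k kn.
have xk : `|k.+1%:R * h| <= 1.
  have kh : 0 <= k.+1%:R * h by rewrite mulr_ge0 ?ler0n ?ltW.
  by rewrite ger0_norm// -[leRHS]nh ler_pM2r// ler_nat ltnW.
have := step _ xk; have := step (- (k.+1%:R * h)); rewrite normrN => /(_ xk).
have -> : - (k.+1%:R * h) + h = - (k%:R * h) by rewrite -natr1; ring.
have -> : - (k.+1%:R * h) - h = - (k.+2%:R * h) by rewrite -[k.+2%:R]natr1; ring.
have -> : k.+1%:R * h + h = k.+2%:R * h by rewrite -[k.+2%:R]natr1; ring.
have -> : k.+1%:R * h - h = k%:R * h by rewrite -natr1; ring.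
by rewrite /u; lra.
Qed.

Lemma expmx_shift (c : R) al be Z x :
  expmx (fun j => c + al j) be Z x = (expR (x * c))%:C *: expmx al be Z x.
Proof.
by apply/matrixP => j k; rewrite !mxE mulrA -rmorphM -expRD -mulrDr addrA.
Qed.

Lemma uinorm_expmx_sqr al be Z :
  N (expmx al be Z 0) ^+ 2 <= N (expmx al be Z 1) * N (expmx al be Z (-1)).
Proof.
apply: mul_le_of_scaled_mean; rewrite ?uinorm_ge0// => t t0.
have := uinorm_expmx_mean (fun j => ln t + al j) be Z.
by rewrite !expmx_shift !uinorm_scale ?expR_ge0// mul0r expR0 !mul1r mulN1r expRN lnK.
Qed.

(* The compression is (1/4) sum of S M S', S in {1, D_a}, S' in {1, D_b}, where
   D_c is the diagonal unitary with entries 1 where c holds and -1 elsewhere. *)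
Lemma uinorm_support_le (a b : 'I_d -> bool) M :
  N (\matrix_(j, k) (M j k *+ (a j && b k))) <= N M.
Proof.
pose s (c : 'I_d -> bool) : 'rV[R[i]]_d := \row_j (-1) ^+ (~~ c j).
have us c : diag_mx (s c) \is unitarymx.
  apply: diag_mx_unitary => j; rewrite mxE.
  by case: (c j); rewrite ?expr0 ?expr1 ?rmorphN ?rmorph1 ?mulrNN mulr1.
pose P (u v : 'rV[R[i]]_d) A := (2^-1)%:C *: (A + diag_mx u *m A *m diag_mx v).
have P_le c c' A : N (P (s c) (s c') A) <= N A.
  rewrite uinorm_scale ?invr_ge0//.
  by have := uinormD A (diag_mx (s c) *m A *m diag_mx (s c')); rewrite uinorm_unitary//; lra.
have PE u v A j k : P u v A j k = (2^-1)%:C * (1 + u 0 j * v 0 k) * A j k.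
  by rewrite mxE [X in _ * X]mxE diag_sandwichE; ring.
(* [s xpredT] is constantly 1: one average kills the rows outside [a], the other the columns outside
   [b]. *)
apply: le_trans (P_le a xpredT M); apply: le_trans (P_le xpredT b _).
rewrite le_eqVlt; apply/orP; left; apply/eqP; congr N; apply/matrixP => j k.
have h2 : (2^-1)%:C * 2 = 1 :> R[i].
  by rewrite -(rmorph_nat (real_complex R)) -rmorphM /= mulVf ?pnatr_eq0.
rewrite !PE !mxE; set q := (2^-1)%:C in h2 *.
case: (a j) (b k) => [] []; rewrite /= ?expr0 ?expr1 ?mulr1n ?mulr0n ?mul1r ?mulr1;
  by rewrite ?subrr ?mulr0 ?mul0r ?mulr0// -[1 + 1]mulr2n h2 !mul1r.
Qed.

End UnitarilyInvariant.

(** * Polar factorisation of a matrix with orthogonal rows *)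

Section Polar.
Variables (C : numClosedFieldType) (d : nat).
Implicit Types (M U : 'M[C]_d) (r : 'rV[C]_d).

Lemma trmxC_mul m n p (A : 'M[C]_(m, n)) (B : 'M[C]_(n, p)) :
  (A *m B)^t* = B^t* *m A^t*.
Proof. by rewrite trmx_mul map_mxM. Qed.

Lemma mulmxtE M j k : (M *m M ^t*) j k = \sum_l M j l * (M k l)^*.
Proof. by rewrite mxE; apply: eq_bigr => l _; rewrite !mxE. Qed.

(* Induction on the number of zeros of r: the corresponding rows of M vanish, and
   one of them can be replaced by a unit vector orthogonal to all rows of M. *)
Lemma polar_rows M r : (forall j, 0 <= r 0 j) ->
  M *m M ^t* = diag_mx (\row_j r 0 j ^+ 2) ->
  exists2 U, U \is unitarymx & M = diag_mx r *m U.
Proof.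
have [m] := ubnP #|[set j | r 0 j == 0]|.
elim: m => // m IH in M r *; rewrite ltnS => rm r0 MM.
have MMe j k : \sum_l M j l * (M k l)^* = (r 0 j ^+ 2) *+ (j == k).
  by rewrite -mulmxtE MM !mxE.
have [/existsP[j0 /eqP rj0]|/existsPn r_neq0] := boolP [exists j, r 0 j == 0]; last first.
  (* Without zeros in r, the rows of M are orthogonal of lengths r_j, and U is obtained by
     normalising them. *)
  exists (diag_mx (\row_j (r 0 j)^-1) *m M).
    apply/unitarymxP/matrixP => j k; rewrite mulmxtE !mxE.
    under eq_bigr do rewrite mul_diag_mx !mxE rmorphM /= mulrACA.
    rewrite -mulr_sumr MMe; case: eqVneq => [->|_]; last by rewrite mulr0n mulr0.
    rewrite mulr1n geC0_conj ?invr_ge0// -expr2 exprVn mulVf// expf_neq0//.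
  apply/matrixP => j k; rewrite !mul_diag_mx !mxE mulrA divff ?mul1r//.
have Mj0 l : M j0 l = 0.
  have /eqP := MMe j0 j0; rewrite rj0 expr0n mul0rn psumr_eq0 => [/allP/(_ l)|k _].
    by rewrite mem_index_enum mul_conjC_eq0 => /(_ isT)/eqP.
  exact: mul_conjC_ge0.
(* The zero row of M makes its adjoint singular; a left kernel vector of the adjoint is orthogonal
   to every row of M. *)
have /eqP/det0P[v v0 vM] : \det (M ^t*) = 0.
  apply/eqP; rewrite det_map_mx det_tr fmorph_eq0; apply/det0P; exists (delta_mx 0 j0).
    by apply/eqP => /rowP/(_ j0)/eqP; rewrite !mxE !eqxx oner_eq0.
  by rewrite -rowE; apply/rowP => l; rewrite !mxE.
have vMe k : \sum_l v 0 l * (M k l)^* = 0.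
  have /rowP/(_ k) := vM; rewrite !mxE => vk; rewrite -[RHS]vk.
  by apply: eq_bigr => l _; rewrite !mxE.
pose z := \sum_l v 0 l * (v 0 l)^*.
have z0 : 0 < z.
  rewrite lt0r sumr_ge0 ?andbT => [|l _]; last exact: mul_conjC_ge0.
  apply: contraNneq v0 => zz; apply/eqP/rowP => l; rewrite mxE.
  have /eqP := zz; rewrite psumr_eq0 => [/allP/(_ l)|k _]; last exact: mul_conjC_ge0.
  by rewrite mem_index_enum mul_conjC_eq0 => /(_ isT)/eqP.
pose c := (sqrtC z)^-1.
have c0 : 0 < c by rewrite invr_gt0 sqrtC_gt0.
have cz : c ^+ 2 * z = 1 by rewrite exprVn sqrtCK mulVf ?gt_eqF.
pose M' := \matrix_(j, l) (if j == j0 then c * v 0 l else M j l).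
pose r' := \row_j (if j == j0 then 1 else r 0 j).
have [|j||U Uu M'E] := IH M' r'.
- apply: leq_trans rm; apply: proper_card; apply/fintype.properP; split.
    by apply/fintype.subsetP => j; rewrite !inE mxE; case: ifP => // _; rewrite oner_eq0.
  by exists j0; rewrite !inE ?rj0 ?eqxx// mxE eqxx oner_eq0.
- by rewrite mxE; case: ifP.
- apply/matrixP => j k; rewrite mulmxtE !mxE.
  under eq_bigr do rewrite !mxE.
  have [->|jj0] := eqVneq j j0; have [kj0|kj0] := eqVneq k j0; rewrite ?expr1n ?kj0 ?(negPf jj0).
  + under eq_bigr do rewrite rmorphM /= mulrACA.
    by rewrite -mulr_sumr (geC0_conj (ltW c0)) -expr2 cz.
  + under eq_bigr do rewrite -mulrA.
    by rewrite -mulr_sumr vMe mulr0.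
  + under eq_bigr do rewrite rmorphM /= mulrCA.
    rewrite -mulr_sumr mulr0n (_ : \sum_l _ = 0) ?mulr0//.
    rewrite -[LHS]conjCK rmorph_sum /= (eq_bigr (fun l => v 0 l * (M j l)^*)) ?vMe ?rmorph0//.
    by move=> l _; rewrite rmorphM /= conjCK mulrC.
  + exact: MMe.
(* The same U serves for M: its row [j0], the only one affected by the change, is multiplied by
   [r 0 j0] = 0. *)
exists U => //; apply/matrixP => j l; rewrite mul_diag_mx mxE.
have [->|jj0] := eqVneq j j0; first by rewrite rj0 mul0r Mj0.
by have /matrixP/(_ j l) := M'E; rewrite mul_diag_mx !mxE (negPf jj0).
Qed.

End Polar.

(** * Real powers through diagonalisation, and the polar decomposition *)

Section MatrixPowers.
Variables (R : realType) (d : nat).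
Implicit Types (A B P Q X Y : 'M[R[i]]_d) (N : 'M[R[i]]_d -> R).

(* The indicator on the right is due to [ln 0 = 0] and [0 `^ 2^-1 = 0]. *)
Lemma expR_ln_powR (a m : R) :
  expR ((m - 2^-1) * ln a) * a `^ 2^-1 = a `^ m *+ (a != 0).
Proof.
rewrite /powR; case: eqVneq => [_|a0]; first by rewrite invr_eq0 pnatr_eq0 mulr0n mulr0.
by rewrite -expRD mulr1n -mulrDl subrK.
Qed.

Definition powdiag (a : 'I_d -> R) (x : R) : 'rV[R[i]]_d := \row_j (a j `^ x)%:C.

Lemma uinorm_powdiag_sqr N (a b : 'I_d -> R) Y (m n s t : R) :
  unitarily_invariant_norm N -> m + n = 1 -> s + t = 1 ->
  N (diag_mx (powdiag a 2^-1) *m Y *m diag_mx (powdiag b 2^-1)) ^+ 2 <=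
    N (diag_mx (powdiag a m) *m Y *m diag_mx (powdiag b s)) *
    N (diag_mx (powdiag a n) *m Y *m diag_mx (powdiag b t)).
Proof.
move=> N_ui mn st.
pose G m s := diag_mx (powdiag a m) *m Y *m diag_mx (powdiag b s).
(* As n - 1/2 = -(m - 1/2) and t - 1/2 = -(s - 1/2), both factors on the right come from one
   exponential family centred at [G 2^-1 2^-1], at x = 1 and x = -1. *)
pose al j := (m - 2^-1) * ln (a j); pose be k := (s - 2^-1) * ln (b k).
have GE m' s' j k : G m' s' j k = (a j `^ m')%:C * (b k `^ s')%:C * Y j k.
  by rewrite diag_sandwichE !mxE.
(* The family vanishes where [a j] or [b k] is 0, since 0^(1/2) = 0, whereas [G] may not because 0^0
   = 1. Only this compression is reached, and its norm is no larger. *)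
pose supp m' s' := \matrix_(j, k) (G m' s' j k *+ ((a j != 0) && (b k != 0))).
have E0 : expmx al be (G 2^-1 2^-1) 0 = G 2^-1 2^-1.
  by apply/matrixP => j k; rewrite mxE mul0r expR0 mul1r.
have E (x m' s' : R) : x * (m - 2^-1) = m' - 2^-1 -> x * (s - 2^-1) = s' - 2^-1 ->
    expmx al be (G 2^-1 2^-1) x = supp m' s'.
  move=> hm hs; apply/matrixP => j k; rewrite mxE GE [RHS]mxE GE mulrDr !mulrA hm hs expRD.
  have -> (p q r r' : R) (y : R[i]) :
      (p * q)%:C * r%:C * r'%:C * y = (p * r)%:C * (q * r')%:C * y.
    by rewrite !rmorphM /=; ring.
  rewrite !expR_ln_powR; case: (a j != 0); case: (b k != 0) => /=;
  by rewrite ?mulr1n ?mulr0n ?rmorph0 ?(mulr0, mul0r).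
have := uinorm_expmx_sqr N_ui al be (G 2^-1 2^-1).
rewrite E0 (E 1 m s) ?mul1r// (E (-1) n t); [|lra|lra].
move=> /le_trans; apply; apply: ler_pM; rewrite ?(uinorm_ge0 N_ui)//.
- exact: (uinorm_support_le N_ui (fun j => a j != 0) (fun k => b k != 0)).
- exact: (uinorm_support_le N_ui (fun j => a j != 0) (fun k => b k != 0)).
Qed.

Definition eigval P (j : 'I_d) : R := complex.Re (spectral_diag P 0 j).

Lemma mxpowR_spectral P : exists U W : 'M[R[i]]_d,
  [/\ U \is unitarymx, W \is unitarymx, U = W^t*,
      forall x, mxpowR P x = U *m diag_mx (powdiag (eigval P) x) *m W &
      P \is normalmx -> P = U *m diag_mx (spectral_diag P) *m W].
Proof.
exists (invmx (spectralmx P)), (spectralmx P); split=> [|||x|].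
- by rewrite invmx_unitary ?trmxC_unitary spectral_unitarymx.
- exact: spectral_unitarymx.
- by rewrite invmx_unitary ?spectral_unitarymx.
2: by move/orthomx_spectralP.
have <- : map_mx (fun z => (complex.Re z `^ x)%:C) (spectral_diag P) =
    powdiag (eigval P) x by apply/rowP => j; rewrite !mxE.
reflexivity.
Qed.

Lemma uinorm_mxpowR_sqr N P Q X (m n s t : R) :
  unitarily_invariant_norm N -> m + n = 1 -> s + t = 1 ->
  N (mxpowR P 2^-1 *m X *m mxpowR Q 2^-1) ^+ 2 <=
    N (mxpowR P m *m X *m mxpowR Q s) * N (mxpowR P n *m X *m mxpowR Q t).
Proof.
move=> N_ui mn st.
have [U [W [Uu Wu _ PE _]]] := mxpowR_spectral P.
have [V [Z [Vu Zu _ QE _]]] := mxpowR_spectral Q.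
pose F x y := N (mxpowR P x *m X *m mxpowR Q y).
pose G x y := N (diag_mx (powdiag (eigval P) x) *m (W *m X *m V)
                 *m diag_mx (powdiag (eigval Q) y)).
(* The outer unitaries disappear in the norm; the inner ones are absorbed into X. *)
have FG x y : F x y = G x y.
  rewrite /F /G PE QE; move: (diag_mx _) (diag_mx (powdiag (eigval Q) y)) => D E.
  by rewrite -(uinorm_unitary N_ui (D *m (W *m X *m V) *m E) Uu Zu) !mulmxA.
have GG : G 2^-1 2^-1 ^+ 2 <= G m s * G n t by exact: uinorm_powdiag_sqr.
suff : F 2^-1 2^-1 ^+ 2 <= F m s * F n t by exact.
by clearbody F G; rewrite !FG.
Qed.

Lemma powdiag_trmxC (a : 'I_d -> R) x :
  (diag_mx (powdiag a x))^t* = diag_mx (powdiag a x).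
Proof.
apply/matrixP => j k; rewrite !mxE eq_sym.
by case: eqVneq => [->|_]; rewrite ?mulr0n ?rmorph0// mulr1n; exact: conjc_real.
Qed.

Lemma mxpowR_trmxC P x : (mxpowR P x)^t* = mxpowR P x.
Proof.
have [U [W [_ _ UE -> _]]] := mxpowR_spectral P.
by rewrite UE !trmxC_mul trmxCK powdiag_trmxC mulmxA.
Qed.

(** With W diagonalising A^*A, the rows of W A^* are orthogonal, of squared lengths the eigenvalues.
    [polar_rows] then factors A^*, and taking adjoints factors A, singular or not. *)
Lemma polar_decomposition A :
  exists2 U, U \is unitarymx & A = U *m mxpowR (A^t* *m A) 2^-1.
Proof.
have [V [W [Vu Wu VE PxE PE]]] := mxpowR_spectral (A^t* *m A).
have {}PE : A^t* *m A = V *m diag_mx (spectral_diag (A^t* *m A)) *m W.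
  by apply: PE; apply/normalmxP; rewrite trmxC_mul trmxCK.
have sqr_eigval j : 0 <= spectral_diag (A^t* *m A) 0 j ->
    (powdiag (eigval (A^t* *m A)) 2^-1) 0 j ^+ 2 = spectral_diag (A^t* *m A) 0 j.
  rewrite mxE /eigval; case: (spectral_diag _ 0 j) => x y; rewrite lecE /=.
  move=> /andP[/eqP -> x0]; rewrite -rmorphXn /= -powR_mulrn ?powR_ge0//.
  by rewrite -powRrM mulVf ?pnatr_eq0// powRr1.
have r0 j : 0 <= (powdiag (eigval (A^t* *m A)) 2^-1) 0 j.
  by rewrite mxE ler0c powR_ge0.
have tD := powdiag_trmxC (eigval (A^t* *m A)) 2^-1.
have {PxE} := PxE 2^-1; move: (mxpowR_trmxC (A^t* *m A) 2^-1).
move: (mxpowR _ _) (powdiag _ _) (spectral_diag _) PE sqr_eigval r0 tD.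
move=> H r L PE sqr_eigval r0 tD HT HE.
have WV : W *m V = 1%:M by rewrite VE; exact/unitarymxP.
have MM : (W *m A^t*) *m (W *m A^t*)^t* = diag_mx L.
  rewrite trmxC_mul trmxCK -VE mulmxA -(mulmxA W) PE.
  by rewrite !mulmxA WV mul1mx -mulmxA WV mulmx1.
(* An eigenvalue is a diagonal entry of a Gram matrix, hence a sum of squared moduli. *)
have L0 j : 0 <= L 0 j.
  have /matrixP/(_ j j) := MM; rewrite mulmxtE mxE eqxx mulr1n => <-.
  by apply: sumr_ge0 => l _; exact: mul_conjC_ge0.
have [|U Uu UE] := polar_rows r0 (M := W *m A^t*).
  by rewrite MM; congr diag_mx; apply/rowP => j; rewrite mxE sqr_eigval.
have VW : V *m W = 1%:M by exact: mulmx1C.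
have AE : A^t* = H *m (V *m U).
  by rewrite HE -!mulmxA (mulmxA W) WV mul1mx -UE mulmxA VW mul1mx.
have VU := mul_unitarymx Vu Uu.
exists ((V *m U)^t*); first by rewrite trmxC_unitary; exact: VU.
by have := congr1 (fun M => M^t*) AE; rewrite trmxCK trmxC_mul HT.
Qed.

End MatrixPowers.

(** * Both inequalities from the one for powers of two matrices *)

Theorem theorem3p2 (R : realType) (d : nat) (N : 'M[R[i]]_d -> R)
    (N_ui : unitarily_invariant_norm N) (A B X : 'M[R[i]]_d) :
  (forall m n s t : R, m + n = 1 -> s + t = 1 ->
     N (A *m X *m B ^t*) ^+ 2 <=
       N (mxpowR (A ^t* *m A) m *m X *m mxpowR (B ^t* *m B) s) *
       N (mxpowR (A ^t* *m A) n *m X *m mxpowR (B ^t* *m B) t)) /\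
  (posdefmx A -> posdefmx B ->
   forall p : R, 0 <= p <= 1 ->
     N (mxpowR A (1 / 2) *m X *m mxpowR B (1 / 2)) ^+ 2 <=
       N (mxpowR A p *m X *m mxpowR B (1 - p)) *
       N (mxpowR A (1 - p) *m X *m mxpowR B p)).
Proof.
split=> [m n s t mn st|_ _ p _]; last first.
  (* Here the powers are those of A and B themselves, with m = t = p and n = s = 1 - p. *)
  by rewrite !div1r; apply: uinorm_mxpowR_sqr; rewrite ?subrK// addrC subrK.
have [U Uu AE] := polar_decomposition A; have [V Vu BE] := polar_decomposition B.
(* The unitary polar factors of A and of B^* stand at the outer ends of the product, so the norm
   ignores them. *)
have -> : N (A *m X *m B^t*) = N (mxpowR (A^t* *m A) 2^-1 *m X *m mxpowR (B^t* *m B) 2^-1).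
  rewrite {1}AE {1}BE trmxC_mul mxpowR_trmxC.
  have [_ Nuv] := N_ui; rewrite -[RHS](Nuv _ U (V^t*)) ?trmxC_unitary//.
  by rewrite !mulmxA.
exact: uinorm_mxpowR_sqr.
Qed.
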